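(* Let $X$ be a $2$-dimensional Banach space over $\mathbb{K}$. Then the pair $(X,X)$ fails property $\mathbf{L}_{o,p}$.
   Context: Banach spaces are over $\mathbb{K}$, which is $\mathbb{R}$ or $\mathbb{C}$. $S_X$ denotes the unit sphere of $X$, and $\mathcal{L}(X,Y)$ the space of bounded linear operators from $X$ to $Y$ with the operator norm. A pair $(X,Y)$ of Banach spaces has property $\mathbf{L}_{o,p}$ if for every $\varepsilon>0$ and every $x\in S_X$ there is $\eta(\varepsilon,x)>0$ such that whenever $T\in\mathcal{L}(X,Y)$ with $\|T\|=1$ satisfies $\|T(x)\|>1-\eta(\varepsilon,x)$, there is $x_0\in S_X$ with $\|T(x_0)\|=1$ and $\|x_0-x\|<\varepsilon$. *)

(* Defs.v *)
From mathcomp Require Import all_boot all_order all_algebra.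
From mathcomp Require Import complex.
From mathcomp Require Import all_classical all_reals all_analysis.

Set Implicit Arguments.
Unset Strict Implicit.
Unset Printing Implicit Defensive.

Import Order.TTheory GRing.Theory Num.Theory.
Import numFieldNormedType.Exports.

Local Open Scope classical_set_scope.
Local Open Scope ring_scope.

Definition is_basis (K : numFieldType) (X : normedModType K) (n : nat)
    (e : 'I_n -> X) : Prop :=
  (forall c : 'I_n -> K, \sum_(i < n) c i *: e i = 0 -> forall i, c i = 0) /\
  (forall x : X, exists c : 'I_n -> K, x = \sum_(i < n) c i *: e i).

Definition has_dim (K : numFieldType) (X : normedModType K) (n : nat) : Prop :=
  exists e : 'I_n -> X, is_basis e.

Definition unit_sphere (K : numFieldType) (X : normedModType K) : set X :=
  [set x | `|x| = 1].

Definition bounded_operator (K : numFieldType) (X Y : normedModType K)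
    (T : {linear X -> Y}) : Prop :=
  exists M : K, forall x : X, `|T x| <= M * `|x|.

(* The norm of a K-normed module takes its values in K, among the nonnegative
   elements.  When K = R[i], the order is partial (x <= y iff y - x is a
   nonnegative real), so the supremum below is taken in the partial order K;
   it is the usual real supremum, since an upper bound of a nonempty set of
   nonnegative elements is itself a nonnegative real. *)
Definition op_norm (K : numFieldType) (X Y : normedModType K)
    (T : {linear X -> Y}) : K :=
  supremum 0 [set `|T x| | x in [set x : X | `|x| <= 1]].

(* For K = R[i], 0 < eps and 0 < eta force eps and eta to be real. *)
Definition property_Lop (K : numFieldType) (X Y : completeNormedModType K)
    : Prop :=
  forall (eps : K) (x : X), 0 < eps -> unit_sphere x ->
  exists eta : K, 0 < eta /\
    forall T : {linear X -> Y}, bounded_operator T -> op_norm T = 1 ->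
      1 - eta < `|T x| ->
      exists x0 : X, [/\ unit_sphere x0, `|T x0| = 1 & `|x0 - x| < eps].

(* Main.v *)
Require Import Defs.
From HB Require Import structures.
From mathcomp Require Import all_boot all_order all_algebra.
From mathcomp Require Import complex.
From mathcomp Require Import all_classical all_reals all_analysis.
From mathcomp Require Import lra.

Set Implicit Arguments.
Unset Strict Implicit.
Unset Printing Implicit Defensive.

Import Order.TTheory GRing.Theory Num.Theory.
Import numFieldNormedType.Exports.

Local Open Scope classical_set_scope.
Local Open Scope ring_scope.
Local Open Scope complex_scope.

(** Let [f] be a functional of norm one attaining its norm at a unit vector
    [u], and let [y] be a unit vector of its kernel.  The operators
    [T x = (1 - t) x + t f(x) u], with [0 < t < 1], average the identity with
    the norm-one projection [f(.) u]: they fix [u], so they have norm one, and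
    [|T y| = 1 - t] is as close to [1] as desired.  But
    [|T x| <= (1 - t) |x| + t |f(x)|], so on the unit sphere [T] attains its
    norm only where [|f| = 1], and such points are at distance at least [1]
    from the kernel of [f], hence from [y].  So the property already fails at
    [y] with [eps = 1]: this is [norm_one_projection_fails_Lop].

    In dimension two such data come from elementary geometry rather than from
    the Hahn-Banach theorem.  Given a basis [v, y], let [w = v + c y] be a
    point of least norm on the line [v + K y].  By homogeneity
    [|a| |w| <= |a v + b y|] for all scalars, so [|w|] times the first
    coordinate is a functional of norm one that attains its norm at [w / |w|]
    and kills [y]; this is [nearest_point_fails_Lop].

    The point of least norm exists over both fields by compactness of closed
    balls in [R^n], with [n = 1] for the real field and [n = 2] for the complex
    one: a norm composed with a bi-Lipschitz parametrization of the line is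
    continuous and large outside a ball ([nearest_point_in_image]). *)

(** * Failure in the presence of a norm-one projection *)

(** The supremum defining the operator norm is here a maximum, reached at the
    fixed vector; so it is [1] even though the scalars are only partially
    ordered. *)
Lemma op_norm_contraction_fixing (K : numFieldType) (X : normedModType K)
    (T : {linear X -> X}) (u : X) :
  (forall x, `|T x| <= `|x|) -> `|u| = 1 -> T u = u -> op_norm T = 1.
Proof.
move=> Tle u1 Tu.
have im1 : [set `|T x| | x in [set x : X | `|x| <= 1]] 1.
  by exists u; rewrite /= ?Tu u1.
have sup1 : supremums [set `|T x| | x in [set x : X | `|x| <= 1]] 1.
  by split=> [_ [x x1 <-]|z]; [exact: le_trans (Tle x) x1|exact].
rewrite /op_norm /supremum ifF; first exact: (xget_subset1 _ sup1 (@is_subset1_supremums _ _ _)).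
by apply/negbTE/set0P; exists 1.
Qed.

(** The operators contradicting the property at [y] are convex combinations of
    the identity, which keeps [|T y|] close to [1], and the projection
    [f(.) u], which keeps norm-attaining points away from the kernel of [f]. *)
Lemma norm_one_projection_fails_Lop (K : numFieldType)
    (X : completeNormedModType K) (f : X -> K) (u y : X) :
  scalar f -> (forall x, `|f x| <= `|x|) -> `|u| = 1 -> f u = 1 ->
  `|y| = 1 -> f y = 0 -> ~ property_Lop X X.
Proof.
move=> flin fle u1 fu y1 fy /(_ 1 y ltr01 y1)[eta [eta0 Heta]].
(* [eta / (1 + eta)] is below both [1] and [eta], with no case analysis on
   which of the two is smaller. *)
have [t [t0 t1 teta]] : exists t : K, [/\ 0 < t, 0 < 1 - t & t < eta].
  have eta1 : 0 < 1 + eta by rewrite addr_gt0.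
  exists (eta / (1 + eta)); split; first exact: divr_gt0.
    by rewrite subr_gt0 ltr_pdivrMr// mul1r ltrDr.
  by rewrite ltr_pdivrMr// ltr_pMr// ltrDl.
pose T x := (1 - t) *: x + (t * f x) *: u.
have Tlin : linear T.
  move=> a x z; rewrite /T flin; move: (1 - t) => s.
  rewrite mulrDr scalerDl !scalerDr !scalerA addrACA.
  by rewrite [s * a]mulrC [t * (a * _)]mulrCA.
pose L : {linear X -> X} := HB.pack T (GRing.isLinear.Build _ _ _ _ T Tlin).
have Tconv x : `|T x| <= (1 - t) * `|x| + t * `|f x|.
  apply: (le_trans (ler_normD _ _)); rewrite !normrZ/= ?normrM u1 mulr1.
  by rewrite (gtr0_norm t0) (gtr0_norm t1).
have Tle x : `|L x| <= `|x|.
  apply: (le_trans (Tconv x)).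
  have xE : (1 - t) * `|x| + t * `|x| = `|x| by rewrite -mulrDl subrK mul1r.
  by rewrite -[leRHS]xE lerD2l ler_pM2l.
have Tu : L u = u by rewrite /= /T fu mulr1 -scalerDl subrK scale1r.
have bL : bounded_operator L by exists 1 => x; rewrite mul1r.
have Ly : 1 - eta < `|L y|.
  by rewrite /= /T fy mulr0 scale0r addr0 normrZ y1 mulr1 gtr0_norm// ltrD2l ltrN2.
have [x0 [x01 Lx0 x0y]] := Heta L bL (op_norm_contraction_fixing Tle u1 Tu) Ly.
(* Subtracting [1 - t] from [1 = |T x0| <= (1 - t) + t |f x0|] and dividing
   by [t] forces [|f x0|] up to [1]. *)
have fx0 : 1 <= `|f x0|.
  have := Tconv x0; rewrite -[T x0]/(L x0) Lx0 x01 mulr1 -lerBlDl opprB addrC subrK.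
  by rewrite -[leLHS]mulr1 ler_pM2l.
have fxy : f (x0 - y) = f x0.
  by rewrite -[- y]scaleN1r addrC flin fy mulr0 add0r.
have := lt_le_trans x0y (le_trans fx0 _).
by rewrite -fxy => /(_ _ (fle _)); rewrite ltxx.
Qed.

(** * Norm-one functionals in dimension two *)

(** The existence of best approximations on lines is left as a hypothesis, as
    it is the only step that depends on the scalar field. *)
Lemma nearest_point_fails_Lop (K : numFieldType)
    (X : completeNormedModType K) :
  has_dim X 2%N ->
  (forall v y : X, y != 0 -> exists c : K, forall d,
     `|v + c *: y| <= `|v + d *: y|) -> ~ property_Lop X X.
Proof.
move=> [e [free span]] near.
pose v := e ord0; pose y := e (lift ord0 ord0).
have indep a b : a *: v + b *: y = 0 -> a = 0 /\ b = 0.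
  move=> ab0; pose c (i : 'I_2) := if i == ord0 then a else b.
  have /free c0 : \sum_(i < 2) c i *: e i = 0.
    by rewrite !big_ord_recl big_ord0 addr0.
  by split; [exact: (c0 ord0)|exact: (c0 (lift ord0 ord0))].
have /choice[c xE] : forall x, exists p : K * K, x = p.1 *: v + p.2 *: y.
  move=> x; have [c ->] := span x.
  exists (c ord0, c (lift ord0 ord0)).
  by rewrite !big_ord_recl big_ord0 addr0.
have uniq a b x : x = a *: v + b *: y -> (c x).1 = a.
  move=> xab; have := xE x; rewrite [LHS]xab => /eqP.
  rewrite -subr_eq0 opprD addrACA -!scalerBl => /eqP/indep[/eqP+ _].
  by rewrite subr_eq0 => /eqP.
have y0 : y != 0.
  apply/eqP => y0; have [] : (0 : K) = 0 /\ (1 : K) = 0.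
    by apply: indep; rewrite y0 scale0r scaler0 addr0.
  by move=> _ /eqP; rewrite oner_eq0.
have [d dmin] := near v y y0.
pose w := v + d *: y.
have w0 : w != 0.
  apply/eqP => w0; have [] : (1 : K) = 0 /\ d = 0.
    by apply: indep; rewrite scale1r.
  by move/eqP; rewrite oner_eq0.
have nw0 : `|w| != 0 by rewrite normr_eq0.
have ny0 : `|y| != 0 by rewrite normr_eq0.
have nrm x : x != 0 -> `|(`|x|^-1 *: x)| = 1 :> K.
  by move=> x0; rewrite normrZ normfV normr_id mulVf// normr_eq0.
apply: (@norm_one_projection_fails_Lop _ _ (fun x => `|w| * (c x).1)
         (`|w|^-1 *: w) (`|y|^-1 *: y)).
- move=> a x z; rewrite mulrCA -mulrDr; congr (_ * _).
  apply: (uniq _ (a * (c x).2 + (c z).2)).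
  by rewrite {1}(xE x) {1}(xE z) !scalerDl scalerDr !scalerA addrACA.
- move=> x; rewrite normrM normr_id.
  have [->|a0] := eqVneq (c x).1 0; first by rewrite normr0 mulr0.
  have -> : x = (c x).1 *: (v + ((c x).1^-1 * (c x).2) *: y).
    by rewrite scalerDr scalerA mulVKf// -xE.
  rewrite [leRHS]normrZ mulrC (uniq (c x).1 (c x).2) ?ler_pM2l ?normr_gt0 ?dmin//.
  by rewrite scalerDr scalerA mulVKf.
- exact: nrm.
- rewrite (uniq `|w|^-1 (`|w|^-1 * d)) ?mulfV//.
  by rewrite /w scalerDr scalerA.
- exact: nrm.
- by rewrite (uniq 0 `|y|^-1) ?mulr0// scale0r add0r.
Qed.

(** * Points of least norm on a line *)

(** The norm is abstracted into a map [N] with values in [R] so that one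
    statement serves real scalars, and complex scalars once the norm is
    composed with the real part.  The bound by [b] makes the function to be
    minimized Lipschitz; the bound by [a] confines its minimization to a
    compact ball. *)
Lemma nearest_point_in_image (R : realType) (X : zmodType) (N : X -> R)
    (n : nat) (L : 'rV[R]_n -> X) (a b : R) (v : X) :
  (forall x z, N (x + z) <= N x + N z) -> (forall x, N (- x) = N x) ->
  {morph L : p q / p - q} -> 0 < a ->
  (forall p, a * `|p| <= N (L p) <= b * `|p|) ->
  exists p, forall q, N (v + L p) <= N (v + L q).
Proof.
move=> ND NN LB a0 Lab.
have L0 : L 0 = 0 by have := LB 0 0; rewrite !subrr.
pose g p := N (v + L p).
have glip p q : `|g p - g q| <= b * `|p - q|.
  have gle p' q' : g p' - g q' <= b * `|p' - q'|.
    have /andP[_ /(le_trans _)] := Lab (p' - q'); apply; rewrite LB lerBlDl.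
    apply: le_trans _ (ND _ _).
    by rewrite addrACA subrr addr0.
  by rewrite ler_norml gle andbT lerNl opprB (le_trans (gle _ _))// distrC.
have gcont : continuous g.
  move=> p; apply/(@cvgrPdist_lt _ _ _ (nbhs p)) => e e0.
  have b1 : 0 < `|b| + 1 by rewrite ltr_wpDl.
  near=> q; apply: le_lt_trans (glip _ _) _.
  apply: (@le_lt_trans _ _ ((`|b| + 1) * `|p - q|)).
    by rewrite ler_wpM2r// (le_trans (ler_norm b))// lerDl.
  rewrite mulrC -ltr_pdivlMr//.
  near: q; have := nbhsx_ballx p _ (divr_gt0 e0 b1).
  by rewrite -ball_normE.
(* If [|p| > r] then [g p >= N (L p) - N v >= a |p| - N v > g 0], so the
   minimum over the ball of radius [r] is global. *)
pose r := (g 0 + N v) / a.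
have far p : r < `|p| -> g 0 < g p.
  rewrite ltr_pdivrMr// mulrC => h.
  have : N (L p) <= g p + N v.
    by rewrite -(NN v) -[L p](addrK v) [L p + v]addrC ND.
  by have /andP[] := Lab p; lra.
have r0 : 0 <= r.
  rewrite divr_ge0 ?(ltW a0)//= /g L0 addr0.
  have := ND v (- v); rewrite subrr NN; have /andP[] := Lab 0.
  by rewrite normr0 mulr0 L0; lra.
have cB : compact [set p : 'rV[R]_n | `|p| <= r].
  apply: bounded_closed_compact.
    by exists r; split; [exact: num_real|move=> s rs p /= /le_trans; apply; exact: ltW].
  have -> : [set p : 'rV[R]_n | `|p| <= r] = closed_ball_ Num.norm 0 r.
    by apply/funext => p; rewrite /closed_ball_ /= sub0r normrN.
  exact: closed_closed_ball_.
have [||p _ pmin] := @compact_EVT_min _ R g _ _ cB.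
- by exists 0; rewrite /= normr0.
- exact: continuous_subspaceT.
exists p => q; have [qr|/far gq] := leP `|q| r.
  by apply: pmin; rewrite inE.
by apply: le_trans (ltW gq); apply: pmin; rewrite inE /= normr0.
Unshelve. all: by end_near. Qed.

Lemma coord_le_norm (R : realType) (n : nat) (p : 'rV[R]_n) (j : 'I_n) :
  `|p ord0 j| <= `|p|.
Proof.
rewrite [leRHS]mx_normrE.
exact: (le_bigmax _ (fun ij : 'I_1 * 'I_n => `|p ij.1 ij.2|) (ord0, j)).
Qed.

Lemma norm_coord_max (R : realType) (n : nat) (p : 'rV[R]_n) :
  `|p| = 0 \/ exists j, `|p| = `|p ord0 j|.
Proof.
have [p0|/mx_norm_neq0[[i j] /= pE]] := eqVneq `|p| 0; first by left.
by right; exists j; move: pE; rewrite ord1.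
Qed.

Lemma nearest_point_real (R : realType) (X : normedModType R) (v y : X) :
  y != 0 -> exists c : R, forall d, `|v + c *: y| <= `|v + d *: y|.
Proof.
move=> y0.
have LB : {morph (fun p : 'rV[R]_1 => p ord0 ord0 *: y) : p q / p - q}.
  by move=> p q; rewrite !mxE scalerBl.
have ny0 : 0 < `|y| by rewrite normr_gt0.
have [p|p pmin] := nearest_point_in_image (b := `|y|) v
  (@ler_normD _ X) (@normrN _ X) LB ny0.
  rewrite normrZ ![`|y| * _]mulrC !ler_pM2r// coord_le_norm andbT.
  by have [->|[j ->]] := norm_coord_max p; rewrite ?(ord1 j).
exists (p ord0 ord0) => d.
by have := pmin (const_mx d); rewrite mxE.
Qed.

(** The sup norm on [R^2] and the modulus of [p0 + i p1] differ by a factor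
    between [1] and [2], which gives the two bounds on the parametrization. *)
Lemma nearest_point_complex (R : realType) (X : normedModType R[i]) (v y : X) :
  y != 0 -> exists c : R[i], forall d, `|v + c *: y| <= `|v + d *: y|.
Proof.
move=> y0.
pose N (x : X) : R := complex.Re `|x|.
have NE x : `|x| = (N x)%:C by rewrite RRe_real// normr_real.
have ND x z : N (x + z) <= N x + N z.
  by rewrite -lecR rmorphD /= -!NE ler_normD.
have NN x : N (- x) = N x by rewrite /N normrN.
have NZ a x : N (a *: x) = Normc.normc a * N x.
  by apply: complexI; rewrite rmorphM /= -!NE normrZ.
have Ny0 : 0 < N y by rewrite -ltcR -NE normr_gt0.
pose z (p : 'rV[R]_2) : R[i] := p ord0 ord0 +i* p ord0 (lift ord0 ord0).
have LB : {morph (fun p => z p *: y) : p q / p - q}.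
  by move=> p q; rewrite -scalerBl; congr (_ *: _); rewrite /z !mxE; simpc.
have [p|p pmin] := nearest_point_in_image (b := 2 * N y) v ND NN LB Ny0.
  have N0 : 0 <= Normc.normc (z p) by rewrite sqrtr_ge0.
  rewrite NZ [N y * _]mulrC [2 * _ * _]mulrAC !ler_pM2r//.
  apply/andP; split.
    have [->//|[j ->]] := norm_coord_max p.
    rewrite -sqrtr_sqr ler_wsqrtr//.
    have [->|->] : j = ord0 \/ j = lift ord0 ord0.
      by case: (unliftP ord0 j) => [k ->|->]; [right; rewrite (ord1 k)|left].
      by rewrite lerDl sqr_ge0.
    by rewrite lerDr sqr_ge0.
  have le1 := coord_le_norm p ord0; have le2 := coord_le_norm p (lift ord0 ord0).
  have : Normc.normc (z p) <= Normc.normc (p ord0 ord0)%:C +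
                              Normc.normc (0 +i* p ord0 (lift ord0 ord0)).
    by rewrite (_ : z p = (p ord0 ord0)%:C + (0 +i* p ord0 (lift ord0 ord0)))
      ?le_normcD// /z; simpc.
  rewrite /= !expr0n /= add0r addr0 !sqrtr_sqr => /le_trans; apply.
  by rewrite mulr_natl mulr2n lerD.
exists (z p) => d.
pose q : 'rV[R]_2 := \row_j (if j == ord0 then complex.Re d else complex.Im d).
have <- : z q = d by rewrite /z !mxE /=; case: (d).
by rewrite !NE lecR pmin.
Qed.

Theorem proposition2p6 (R : realType) :
  (forall X : completeNormedModType R, has_dim X 2%N -> ~ property_Lop X X) /\
  (forall X : completeNormedModType R[i], has_dim X 2%N -> ~ property_Lop X X).
Proof.
split=> X dim2; apply: (nearest_point_fails_Lop dim2) => v y.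
- exact: nearest_point_real.
- exact: nearest_point_complex.
Qed.
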